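(* Let $G=(A\cup B,E)$ be a bipartite graph with vertex set $V=A\cup B$, where every vertex $v\in V$ has a strict preference order $\succ_v$ over its neighbours, and let $w:V\to\mathbb{Q}_{\ge 0}$ be vertex weights. A matching $M$ of $G$ is popular if and only if there exists a vector $\mathbf{y}\in\mathbb{Q}^{V}$ with $\sum_{v\in V}\mathbf{y}_v=0$ such that $\mathbf{y}_u+\mathbf{y}_v\ge \mathsf{vote}^M(\{u,v\})$ for every edge $\{u,v\}\in E$, $\mathbf{y}_v\ge 0$ for every vertex $v$ unmatched by $M$, and $\mathbf{y}_v\ge -w(v)$ for every $v\in V$.
   Context: Every vertex prefers being matched to any neighbour over being unmatched. For a matching $M$ and $v\in V$, $M(v)$ denotes the partner of $v$ in $M$ ($M(v)=\square$ if $v$ is unmatched). For matchings $M,M'$, let $V^+(M,M')$ be the set of vertices $v$ with $M(v)\succ_v M'(v)$ (being matched beats being unmatched), and $\Delta_w(M,M')=\sum_{v\in V^+(M,M')}w(v)-\sum_{v\in V^+(M',M)}w(v)$. A matching $M$ is popular if $\Delta_w(M,M')\ge 0$ for every matching $M'$. For $u\in V$ and a neighbour $v$ of $u$: $\mathsf{vote}^M_u(v)=0$ if $\{u,v\}\in M$; $\mathsf{vote}^M_u(v)=w(u)$ if $u$ is unmatched in $M$ or $v\succ_u M(u)$; and $\mathsf{vote}^M_u(v)=-w(u)$ otherwise. For an edge $\{u,v\}$, $\mathsf{vote}^M(\{u,v\})=\mathsf{vote}^M_u(v)+\mathsf{vote}^M_v(u)$. *)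

(* Defs.v *)
From mathcomp Require Import all_boot all_order all_algebra.

Set Implicit Arguments.
Unset Strict Implicit.
Unset Printing Implicit Defensive.

Import Order.TTheory GRing.Theory Num.Theory.
Local Open Scope ring_scope.

Section PopularMatchings.

Variable V : finType.

(* A simple graph on V is given by its set E of edges, an edge being the
   unordered pair [set u; v] of its endpoints. *)
Definition bipartite (A B : {set V}) (E : {set {set V}}) : Prop :=
  [/\ A :|: B = [set: V],
      [disjoint A & B] &
      forall f, f \in E ->
        exists a b, [/\ a \in A, b \in B & f = [set a; b]]].

Definition neighbours (E : {set {set V}}) (v : V) : {set V} :=
  [set u | [set v; u] \in E].

(* succ v x y reads "v strictly prefers x to y"; only its restriction to the
   neighbours of v is constrained. *)
Definition strict_preferences (E : {set {set V}}) (succ : V -> rel V) : Prop :=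
  forall v : V,
    [/\ {in neighbours E v, irreflexive (succ v)},
        {in neighbours E v & &, transitive (succ v)} &
        {in neighbours E v &, forall x y, x != y -> succ v x y || succ v y x}].

Definition matching (E M : {set {set V}}) : bool :=
  (M \subset E) && trivIset M.

(* None when v is unmatched; the partner is unique when M is a matching. *)
Definition partner (M : {set {set V}}) (v : V) : option V :=
  [pick u | [set v; u] \in M].

Definition unmatched (M : {set {set V}}) (v : V) : bool :=
  v \notin cover M.

Section Votes.

Variables (succ : V -> rel V) (w : V -> rat).

Definition succ_opt (v : V) (p q : option V) : bool :=
  match p, q with
  | Some x, Some y => succ v x y
  | Some _, None => true
  | None, _ => false
  end.

Definition Vplus (M M' : {set {set V}}) : {set V} :=
  [set v | succ_opt v (partner M v) (partner M' v)].

Definition Delta (M M' : {set {set V}}) : rat :=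
  \sum_(v in Vplus M M') w v - \sum_(v in Vplus M' M) w v.

Definition popular (E M : {set {set V}}) : Prop :=
  forall M' : {set {set V}}, matching E M' -> 0 <= Delta M M'.

Definition vote (M : {set {set V}}) (u v : V) : rat :=
  if [set u; v] \in M then 0
  else if unmatched M u || succ_opt u (Some v) (partner M u) then w u
  else - w u.

Definition edge_vote (M : {set {set V}}) (u v : V) : rat :=
  vote M u v + vote M v u.

End Votes.

End PopularMatchings.

(* Main.v *)
(** Give a vertex left alone the mate itself, so that matchings become
    involutions.  Let [d v x] be the gain of [v] over [M] when its mate becomes
    [x]; then [Delta M' M = \sum_v d v (mate M' v)].  With the symmetric gain
    [c u v = d u v + d v u], a vector [y] of total [0] with
    [c u v <= y u + y v] on edges and loops bounds every [Delta M' M] by [0].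

    Conversely, let [mu] be the involution of [M], and look for a potential [p]
    with [c u (mu v) <= p u - p v]; then [y u = (p u - p (mu u)) / 2] is the
    required vector.  Such a [p], the largest weight of a simple path from [u],
    exists as soon as no permutation has positive total weight.  But a
    permutation [s] of a bipartite graph splits into two matchings: [s] on [A]
    with [s^-1] on [B], and the other way round, whose gains add up to
    [\sum_v c v (s v)]. *)
Require Import Defs.
From mathcomp Require Import all_boot all_order all_algebra.
From mathcomp Require Import fingroup perm lra.

Set Implicit Arguments.
Unset Strict Implicit.
Unset Printing Implicit Defensive.

Import Order.TTheory GRing.Theory Num.Theory.
Local Open Scope ring_scope.

(** * Potentials on a digraph without positive cycles *)

Section Potential.

Variables (T : finType) (e : rel T) (g : T -> T -> rat).

Fixpoint path_weight (x : T) (s : seq T) : rat :=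
  if s is y :: s' then g x y + path_weight y s' else 0.

Lemma path_weight_cat x s1 s2 :
  path_weight x (s1 ++ s2) = path_weight x s1 + path_weight (last x s1) s2.
Proof.
elim: s1 x => [|y s1 IH] x /=; first by rewrite add0r.
by rewrite IH addrA.
Qed.

Lemma sum_next x s : uniq (x :: s) ->
  \sum_(z <- x :: s) g z (next (x :: s) z) = path_weight x (rcons s x).
Proof.
move=> Us.
(* The induction needs the return point [x0] independent of the start [y0]. *)
suff H x0 y0 t : uniq (y0 :: t) ->
    \sum_(z <- y0 :: t) g z (next_at z x0 y0 t) = path_weight y0 (rcons t x0).
  exact: H.
elim: t y0 => [|y t IH] y0; first by rewrite big_seq1 /= eqxx addr0.
rewrite cons_uniq => /andP[y0t Ut].
rewrite big_cons [in RHS]/= -IH // [next_at y0 _ _ _]/= eqxx; congr (_ + _).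
apply: eq_big_seq => z zt /=; case: eqVneq => // zy0.
by rewrite -zy0 zt in y0t.
Qed.

Hypothesis e_refl : reflexive e.
Hypothesis g_diag : forall x, g x x = 0.
Hypothesis perm_le0 : forall s : {perm T},
  (forall x, e x (s x)) -> \sum_x g x (s x) <= 0.

(** The cycle extends to a permutation fixing every other vertex; the added loops are arcs by
    [e_refl] and weigh nothing by [g_diag]. *)
Lemma cycle_weight_le0 x s :
  path e x (rcons s x) -> uniq (x :: s) -> path_weight x (rcons s x) <= 0.
Proof.
move=> es Us; pose t := perm (can_inj (prev_next Us)).
have -> : path_weight x (rcons s x) = \sum_z g z (t z).
  rewrite -sum_next // big_uniq //= [RHS](bigID (mem (x :: s))) /=.
  rewrite [X in _ = _ + X]big1 ?addr0 => [|z zs].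
    by apply: eq_bigr => z _; rewrite permE.
  by rewrite permE next_nth (negPf zs).
apply: perm_le0 => z; rewrite permE.
have [zs|zs] := boolP (z \in x :: s); first exact: (@next_cycle _ e (x :: s)).
by rewrite next_nth (negPf zs).
Qed.

Definition simple_path x s := path e x s && uniq (x :: s).

Lemma potential_exists :
  exists p : T -> rat, forall x y, e x y -> g x y <= p x - p y.
Proof.
(* Simple paths have bounded length, so they live in a finite type and a heaviest one exists; the
   empty path is the default. *)
pose ok x (s : #|T|.-bseq T) := simple_path x s.
pose best x := [arg max_(s > [bseq] | ok x s) path_weight x s]%O.
have bestP x : ok x (best x) /\
    forall s, simple_path x s -> path_weight x s <= path_weight x (best x).
  rewrite /best; case: arg_maxP => // s oks maxs; split=> // t okt.
  have szt : (size t <= #|T|)%N.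
    have /andP[_ /= /andP[_ Ut]] := okt.
    by rewrite -(card_uniqP Ut) max_card.
  exact: (maxs (Bseq szt)).
exists (fun x => path_weight x (best x)) => x y exy.
have [/andP[ey Uy] _] := bestP y; have [_ maxx] := bestP x.
rewrite lerBrDr; set s : seq T := best y in ey Uy *.
have [xs|xs] := boolP (x \in y :: s); last first.
  by apply: (maxx (y :: s)); rewrite /simple_path /= exy ey xs.
move: xs; rewrite inE => /predU1P[xy|xs].
  by rewrite -xy g_diag add0r in ey Uy *; apply: maxx; rewrite /simple_path ey.
(* Closing the path from y back at x splits off a cycle, of weight at most 0. *)
case/splitPr: xs ey Uy => s1 s2 ey Uy.
rewrite -cat_cons cat_uniq in Uy.
have /and3P[Us1 /= /norP[xs1 _] Us2] := Uy.
move: ey; rewrite cat_path => /and3P[es1 elx es2].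
have : path_weight x (rcons (y :: s1) x) <= 0.
  apply: cycle_weight_le0; last by rewrite cons_uniq xs1.
  by rewrite rcons_path /= exy es1.
rewrite -cats1 path_weight_cat /=.
have : path_weight x s2 <= path_weight x (best x).
  by apply: maxx; apply/andP.
rewrite path_weight_cat /=; lra.
Qed.

End Potential.

Lemma set2_eq (T : finType) (a b x y : T) :
  [set a; b] = [set x; y] -> (a = x /\ b = y) \/ (a = y /\ b = x).
Proof.
move=> eq2; have := set21 a b; have := set22 a b; rewrite eq2 !inE.
have := set21 x y; have := set22 x y; rewrite -eq2 !inE.
do 4 case/pred2P => ?; subst; auto.
Qed.

(** * Matchings as involutions *)

Section Popular.

Variables (V : finType) (E : {set {set V}}).

(** The splitting of permutations uses bipartiteness only in this form, for [A] and for its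
    complement. *)
Definition crosses (S : {set V}) : Prop :=
  forall u v, [set u; v] \in E -> (u \in S) = (v \notin S).

Lemma bipartite_crosses (A B : {set V}) :
  bipartite A B E -> crosses A /\ crosses (~: A).
Proof.
case=> _ dAB Eab.
have cA : crosses A.
  move=> u v /Eab [a] [b] [aA bB /set2_eq] bA.
  have {}bB : b \notin A by rewrite (disjointFl dAB).
  by case: bA => [[-> ->]|[-> ->]]; rewrite ?aA ?(negPf bB).
by split=> // u v /cA; rewrite !inE => ->.
Qed.

Definition mate (M : {set {set V}}) (v : V) : V := odflt v (partner M v).

Definition adjacent_or_eq (u v : V) : bool := (u == v) || ([set u; v] \in E).

Lemma adjacent_or_eq_sym : symmetric adjacent_or_eq.
Proof. by move=> u v; rewrite /adjacent_or_eq eq_sym setUC. Qed.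

Section Matching.

Hypothesis loopless : forall v, [set v; v] \notin E.

Section Partner.

Variable M : {set {set V}}.
Hypothesis matM : matching E M.

Lemma partner_edge v u : partner M v = Some u -> [set v; u] \in M.
Proof. by rewrite /partner; case: pickP => // x xM [<-]. Qed.

(** Edges of a matching that share [v] coincide, so the choice made by [pick] is forced. *)
Lemma edge_partner v u : [set v; u] \in M -> partner M v = Some u.
Proof.
have /andP[_ tM] := matM; move=> vuM; rewrite /partner.
case: pickP => [x vxM|/(_ u)]; last by rewrite vuM.
congr Some; have [/set2_eq|neq] := eqVneq [set v; x] [set v; u].
  by case=> [[_ ->]|[<- ->]].
have /trivIsetP/(_ _ _ vxM vuM neq)/disjointFr/(_ (set21 _ _)) := tM.
by rewrite set21.
Qed.

Lemma mateK : involutive (mate M).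
Proof.
move=> v; rewrite /mate; case pv: (partner M v) => [u|] /=; last by rewrite pv.
by have /partner_edge := pv; rewrite setUC => /edge_partner ->.
Qed.

Lemma mate_adjacent v : adjacent_or_eq v (mate M v).
Proof.
have /andP[/subsetP ME _] := matM; rewrite /mate /adjacent_or_eq.
case pv: (partner M v) => [u|] /=; last by rewrite eqxx.
by rewrite (ME _ (partner_edge pv)) orbT.
Qed.

End Partner.

(** Construction converse to [mate]: fixed points of [t] become unmatched vertices. *)
Definition matching_of (t : V -> V) : {set {set V}} :=
  [set [set v; t v] | v in [pred v | t v != v]].

Section MatchingOf.

Variable t : V -> V.
Hypothesis tK : involutive t.

Lemma mem_matching_of v u :
  ([set v; u] \in matching_of t) = (t v != v) && (u == t v).
Proof.
apply/imsetP/andP => [[x]|[tv /eqP ->]]; last by exists v.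
rewrite inE => tx /set2_eq [[-> ->]|[-> ->]]; first by rewrite tx eqxx.
by rewrite tK eq_sym tx eqxx.
Qed.

Lemma matching_of_matching :
  (forall v, adjacent_or_eq v (t v)) -> matching E (matching_of t).
Proof.
move=> tE; apply/andP; split.
  apply/subsetP => _ /imsetP[v tv ->]; rewrite inE in tv.
  by have := tE v; rewrite /adjacent_or_eq eq_sym (negPf tv).
(* Each of its vertices determines the edge, so two edges that meet are equal. *)
have atP z x : z \in [set x; t x] -> [set x; t x] = [set z; t z].
  by rewrite !inE => /pred2P[->//|->]; rewrite tK setUC.
apply/trivIsetP => _ _ /imsetP[x _ ->] /imsetP[y _ ->]; apply: contraNT.
by case/pred0Pn => z /andP[/= /atP -> /atP ->].
Qed.

Lemma mate_matching_of : mate (matching_of t) =1 t.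
Proof.
move=> v; rewrite /mate /partner; case: pickP => [u|/(_ (t v))] /=.
  by rewrite mem_matching_of => /andP[_ /eqP].
by rewrite mem_matching_of eqxx andbT => /negbFE/eqP.
Qed.

End MatchingOf.

Hypothesis edges_are_pairs :
  forall f, f \in E -> exists a b, f = [set a; b].

Lemma unmatchedE M v :
  matching E M -> unmatched M v = (partner M v == None).
Proof.
move=> matM; have /andP[/subsetP ME _] := matM; rewrite /unmatched.
case pv: (partner M v) => [u|] /=.
  apply/negbTE; rewrite negbK; apply/bigcupP; exists [set v; u].
    exact: partner_edge.
  exact: set21.
apply/bigcupP => -[f fM]; have [a [b fab]] := edges_are_pairs (ME _ fM).
rewrite {}fab in fM *; rewrite !inE => /pred2P[] va; subst v.
  by rewrite (edge_partner matM fM) in pv.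
by rewrite setUC in fM; rewrite (edge_partner matM fM) in pv.
Qed.

(** * Gains of single vertices over [M] *)

Section Gain.

Variables (succ : V -> rel V) (w : V -> rat) (M : {set {set V}}).
Hypothesis prefs : strict_preferences E succ.
Hypothesis matM : matching E M.

Definition alone_gain v : rat := if unmatched M v then 0 else - w v.

Definition gain (v u : V) : rat :=
  if u == v then alone_gain v else vote succ w M v u.

Lemma gain_diff M' v : matching E M' ->
  (if v \in Vplus succ M' M then w v else 0)
    - (if v \in Vplus succ M M' then w v else 0) = gain v (mate M' v).
Proof.
move=> matM'; have /andP[/subsetP ME' _] := matM'.
have /andP[/subsetP ME _] := matM.
rewrite !inE /gain /mate /alone_gain /vote (unmatchedE _ matM).
case pv': (partner M' v) => [u|] /=; last first.
  by rewrite eqxx; case: (partner M v) => [x|] /=; lra.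
have vuE := ME' _ (partner_edge pv').
have uv : u != v by apply: contraTneq vuE => ->; apply: loopless.
rewrite (negPf uv); case pv: (partner M v) => [x|] /=; last first.
  case: ifP => [/(edge_partner matM)|_]; last by lra.
  by rewrite pv.
have vxM := partner_edge pv; have vxE := ME _ vxM.
have [irr tr tot] := prefs v.
have un : u \in neighbours E v by rewrite inE.
have xn : x \in neighbours E v by rewrite inE.
have [ux|ux] := eqVneq u x; first by rewrite ux vxM subrr.
have -> : [set v; u] \in M = false.
  apply: contraNF ux => /(edge_partner matM); rewrite pv => -[->].
  exact: eqxx.
(* For distinct partners, totality gives one strict preference, and transitivity with irreflexivity
   excludes the other. *)
have := tot _ _ un xn ux; case uvx: (succ v u x) => /= xvu; last first.
  by rewrite xvu sub0r.
case xvu': (succ v x u); last by rewrite subr0.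
by have := tr _ _ _ xn un un uvx xvu'; rewrite irr.
Qed.

Lemma Delta_gain M' :
  matching E M' -> Delta succ w M M' = - \sum_v gain v (mate M' v).
Proof.
move=> matM'; rewrite /Delta -opprB; congr (- _).
rewrite big_mkcond [X in _ - X]big_mkcond /= -sumrB.
by apply: eq_bigr => v _; apply: gain_diff.
Qed.

Definition sym_gain u v : rat := gain u v + gain v u.

Lemma sym_gainC u v : sym_gain u v = sym_gain v u.
Proof. exact: addrC. Qed.

Lemma sym_gain_edge u v :
  [set u; v] \in E -> sym_gain u v = edge_vote succ w M u v.
Proof.
move=> uvE; have uv : u != v by apply: contraTneq uvE => ->; apply: loopless.
by rewrite /sym_gain /gain eq_sym (negPf uv).
Qed.

Lemma sym_gain_diag v : sym_gain v v = alone_gain v *+ 2.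
Proof. by rewrite /sym_gain /gain eqxx mulr2n. Qed.

(** Keeping the present mate changes nothing; this supplies [g_diag] once arcs are twisted by
    [mate M]. *)
Lemma sym_gain_mate v : sym_gain v (mate M v) = 0.
Proof.
rewrite /sym_gain /gain /mate /alone_gain /vote !(unmatchedE _ matM).
case pv: (partner M v) => [u|] /=; last by rewrite eqxx pv addr0.
have vuM := partner_edge pv; rewrite [[set u; v]]setUC vuM eq_sym.
have /andP[/subsetP/(_ _ vuM) vuE _] := matM.
case: eqVneq => [vu|_]; last by rewrite addr0.
by rewrite vu (negPf (loopless _)) in vuE.
Qed.

(** * Witnesses and popularity *)

Definition witness (y : V -> rat) : Prop :=
  forall u v, adjacent_or_eq u v -> sym_gain u v <= y u + y v.

Lemma witness_popular y :
  \sum_v y v = 0 -> witness y -> popular succ w E M.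
Proof.
move=> y0 wit M' matM'; rewrite Delta_gain // oppr_ge0.
have mateI := inv_inj (mateK matM').
(* Since [mate M'] is an involution, this sum is twice the total gain. *)
suff : \sum_v sym_gain v (mate M' v) <= 0.
  rewrite /sym_gain big_split /=.
  rewrite [X in _ + X](reindex_inj mateI) /=.
  under [X in _ + X]eq_bigr => v _ do rewrite (mateK matM').
  lra.
have sum_y2 : \sum_v (y v + y (mate M' v)) = 0.
  by rewrite big_split /= y0 add0r -[RHS]y0 [RHS](reindex_inj mateI).
by rewrite -[leRHS]sum_y2; apply: ler_sum => v _; apply/wit/mate_adjacent.
Qed.

Definition half_perm (S : {set V}) (s : {perm V}) (v : V) : V :=
  if v \in S then s v else (s^-1)%g v.

Lemma perm_inv_adjacent (s : {perm V}) :
  (forall v, adjacent_or_eq v (s v)) ->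
  forall v, adjacent_or_eq v ((s^-1)%g v).
Proof.
by move=> sE v; have := sE ((s^-1)%g v); rewrite permKV adjacent_or_eq_sym.
Qed.

(** A vertex moved by one of [s], [s^-1] lands on the other side, where the inverse brings it back;
    fixed points stay fixed. *)
Lemma half_permK (S : {set V}) (s : {perm V}) :
  crosses S -> (forall v, adjacent_or_eq v (s v)) -> involutive (half_perm S s).
Proof.
move=> cS sE v; rewrite /half_perm.
have [vS|vS] := boolP (v \in S).
  have /predU1P[vs|/cS] := sE v; first by rewrite -vs vS -vs.
  by rewrite vS => /esym/negPf ->; rewrite permK.
have /predU1P[vs|/cS] := perm_inv_adjacent sE v.
  by rewrite -vs (negPf vS) -vs.
by rewrite (negPf vS) => /esym/negbFE ->; rewrite permKV.
Qed.

Lemma popular_perm_le0 (S : {set V}) (s : {perm V}) :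
  crosses S -> crosses (~: S) -> popular succ w E M ->
  (forall v, adjacent_or_eq v (s v)) -> \sum_v sym_gain v (s v) <= 0.
Proof.
move=> cS cS' popM sE.
have half (S' : {set V}) : crosses S' -> \sum_v gain v (half_perm S' s v) <= 0.
  move=> cS''; have tK := half_permK cS'' sE.
  have matt : matching E (matching_of (half_perm S' s)).
    apply: matching_of_matching => // v; rewrite /half_perm.
    by case: ifP => _; [apply: sE | apply: perm_inv_adjacent].
  have := popM _ matt; rewrite Delta_gain // oppr_ge0.
  by under eq_bigr => v _ do rewrite mate_matching_of //.
suff -> : \sum_v sym_gain v (s v) =
    \sum_v gain v (half_perm S s v) + \sum_v gain v (half_perm (~: S) s v).
  by have := half _ cS; have := half _ cS'; lra.
(* Reindexing turns [gain (s v) v] into [gain v (s^-1 v)]; each vertex follows [s] in one half and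
   [s^-1] in the other. *)
rewrite /sym_gain big_split /= [X in _ + X = _](reindex_inj (@perm_inj _ s^-1)).
under [X in _ + X = _]eq_bigr => v _ do rewrite permKV.
rewrite -!big_split /=; apply: eq_bigr => v _.
by rewrite /half_perm inE; case: ifP => _ //=; rewrite addrC.
Qed.

Lemma popular_witness (S : {set V}) :
  crosses S -> crosses (~: S) -> popular succ w E M ->
  exists2 y, \sum_v y v = 0 & witness y.
Proof.
move=> cS cS' popM; have muK := mateK matM; have muI := inv_inj muK.
pose mu := mate M; pose e u v := adjacent_or_eq u (mu v).
have [|v|s se|p pP] := @potential_exists _ e (fun u v => sym_gain u (mu v)).
- by move=> v; apply: mate_adjacent.
- exact: sym_gain_mate.
(* Following [s] by [mu] turns each arc of [e] into an edge or a loop. *)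
- have := @popular_perm_le0 S (s * perm muI)%g cS cS' popM.
  under eq_bigr => v _ do rewrite permM permE.
  by apply=> v; rewrite permM permE; apply: se.
exists (fun v => (p v - p (mu v)) / 2).
  rewrite -mulr_suml sumrB /= [X in X - _](reindex_inj muI) /= subrr.
  by rewrite mul0r.
move=> u v uv.
(* The bounds for the arcs from [u] to [mu v] and from [v] to [mu u] add up to twice the required
   inequality. *)
have := pP u (mu v); rewrite /e /mu muK => /(_ uv).
have := pP v (mu u); rewrite /e /mu muK adjacent_or_eq_sym => /(_ uv).
rewrite (sym_gainC v u); lra.
Qed.

(** The loop at [v] says [alone_gain v <= y v], which merges the two conditions on single vertices:
    when [v] is unmatched, [0 <= y v] implies [- w v <= y v]. *)
Lemma witnessP y : (forall v, 0 <= w v) ->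
  witness y <->
  [/\ forall u v : V, [set u; v] \in E -> edge_vote succ w M u v <= y u + y v,
      forall v : V, unmatched M v -> 0 <= y v &
      forall v : V, - w v <= y v].
Proof.
move=> w_ge0; split=> [wit|[edge unm low] u v].
  have alone v : alone_gain v <= y v.
    by have := wit v v; rewrite /adjacent_or_eq eqxx sym_gain_diag => /(_ isT); lra.
  split=> [u v uvE|v vM|v].
  - by rewrite -sym_gain_edge //; apply: wit; rewrite /adjacent_or_eq uvE orbT.
  - by have := alone v; rewrite /alone_gain vM.
  - apply: le_trans (alone v); rewrite /alone_gain.
    by case: ifP => // _; rewrite oppr_le0.
case/predU1P => [<-|uvE]; last by rewrite sym_gain_edge // edge.
rewrite sym_gain_diag /alone_gain; have := low u; have := unm u.
by case: ifP => // _ => [/(_ isT)|_]; lra.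
Qed.

End Gain.

End Matching.

End Popular.

Theorem theorem5 (V : finType) (A B : {set V}) (E : {set {set V}})
    (succ : V -> rel V) (w : V -> rat) (M : {set {set V}}) :
  bipartite A B E ->
  strict_preferences E succ ->
  (forall v : V, 0 <= w v) ->
  matching E M ->
  popular succ w E M <->
  exists y : V -> rat,
    [/\ \sum_(v : V) y v = 0,
        forall u v : V, [set u; v] \in E -> edge_vote succ w M u v <= y u + y v,
        forall v : V, unmatched M v -> 0 <= y v &
        forall v : V, - w v <= y v].
Proof.
move=> bip prefs w_ge0 matM; have [cA cA'] := bipartite_crosses bip.
have loopless v : [set v; v] \notin E.
  by apply/negP => /cA; case: (v \in A).
have pairs f : f \in E -> exists a b, f = [set a; b].
  by have [_ _ Eab] := bip; case/Eab => a [b [_ _ ->]]; exists a, b.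
split=> [popM|[y [y0 edge unm low]]].
  have [y y0] := popular_witness loopless pairs prefs matM cA cA' popM.
  by case/(witnessP loopless succ M y w_ge0) => edge unm low; exists y.
apply: (witness_popular loopless pairs prefs matM y0).
exact/(witnessP loopless succ M y w_ge0).
Qed.
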